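(* Let $D$ be an uncertain quantitative database over a finite item set $I$, let $\alpha\in(0,1]$, $\beta$, $\gamma$ be the minimum support, utility occupancy and probability thresholds, and let $\prec$ be the support-ascending total order on $I$. Let $X$ be a nonempty itemset, viewed as a node of the SC-tree. If $pro(X)\ge\gamma$, then $X$ is a high probability pattern. If $pro(X)<\gamma$, then $X$ and all nodes of the subtree of the SC-tree rooted at $X$ can be pruned; that is, neither $X$ nor any descendant of $X$ in the SC-tree is a potential high utility-occupancy pattern with respect to $\alpha,\beta,\gamma$.
   Context: An uncertain quantitative database is a nonempty finite collection $D=\{T_1,\dots,T_n\}$ of transactions, with $|D|=n$. Each transaction $T_k$ is a nonempty subset of a finite item set $I$. Each item $i\in T_k$ carries a quantity $q(i,T_k)$ (a positive integer) and an existence probability $p(i,T_k)\in(0,1]$. Each item $i\in I$ has a unit utility $p(i)>0$. An itemset (pattern) is a subset $X\subseteq I$. Put $\Gamma_X=\{T_k\in D: X\subseteq T_k\}$ and $SC(X)=|\Gamma_X|$ (the support count). Utility: $u(i,T_k)=p(i)\,q(i,T_k)$ for $i\in T_k$; $u(X,T_k)=\sum_{i\in X}u(i,T_k)$ for $X\subseteq T_k$; $tu(T_k)=\sum_{i\in T_k}u(i,T_k)$. Utility occupancy: $uo(X,T_k)=u(X,T_k)/tu(T_k)$ for $X\subseteq T_k$, and $uo(X)=\frac{1}{|\Gamma_X|}\sum_{T_k\in\Gamma_X}uo(X,T_k)$ when $\Gamma_X\neq\emptyset$. Probability: $p(X,T_k)=\prod_{i\in X}p(i,T_k)$ for $X\subseteq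 T_k$, and $pro(X)=\sum_{T_k\in\Gamma_X}p(X,T_k)$. A pattern $X$ is called a high probability pattern if $pro(X)\ge\gamma$. The order $\prec$ is a total order on $I$ in which items are listed by ascending support count $SC(\{i\})$ (ties broken arbitrarily but in a fixed way). For an itemset $X$ and item $i$, $X\prec i$ means that every item of $X$ precedes $i$. The SC-tree is the set-enumeration tree of $I$ with respect to $\prec$: its root is $\emptyset$, its nodes are the itemsets, and the children of a node $X$ are the itemsets $X\cup\{i\}$ with $i\in I\setminus X$ and $X\prec i$. Thus the descendants of $X$ are the itemsets $X\cup Z$ with $Z\neq\emptyset$ and $X\prec i$ for all $i\in Z$. An itemset $X$ is a potential high utility-occupancy pattern (PHUOP) if $SC(X)\ge\alpha|D|$, $uo(X)\ge\beta$ and $pro(X)\ge\gamma$. *)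

(* Defs.v *)
From mathcomp Require Import all_boot all_order all_algebra.

Set Implicit Arguments.
Unset Strict Implicit.
Unset Printing Implicit Defensive.

Import Order.TTheory GRing.Theory Num.Theory.
Local Open Scope ring_scope.

(* Transactions are indexed by 'I_(dbsize), so that two transactions may consist
   of the same items.  The values of qty i k and prob i k are meaningful only
   when i \in trans k. *)
Record uqdb (R : realFieldType) (I : finType) := UQDB {
  dbsize : nat;
  trans : 'I_dbsize -> {set I};
  qty : I -> 'I_dbsize -> nat;
  prob : I -> 'I_dbsize -> R;
  unit_utility : I -> R;
  dbsize_gt0 : (0 < dbsize)%N;
  trans_neq0 : forall k, trans k != set0;
  qty_gt0 : forall i k, i \in trans k -> (0 < qty i k)%N;
  prob_itv : forall i k, i \in trans k -> 0 < prob i k <= 1;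
  unit_utility_gt0 : forall i, 0 < unit_utility i
}.

Definition supporting (R : realFieldType) (I : finType) (D : uqdb R I)
    (X : {set I}) : {set 'I_(dbsize D)} :=
  [set k | X \subset trans k].

Definition support_count (R : realFieldType) (I : finType) (D : uqdb R I)
    (X : {set I}) : nat :=
  #|supporting D X|.

Definition item_utility (R : realFieldType) (I : finType) (D : uqdb R I)
    (i : I) (k : 'I_(dbsize D)) : R :=
  unit_utility D i * (qty i k)%:R.

Definition utility_in (R : realFieldType) (I : finType) (D : uqdb R I)
    (X : {set I}) (k : 'I_(dbsize D)) : R :=
  \sum_(i in X) item_utility i k.

Definition trans_utility (R : realFieldType) (I : finType) (D : uqdb R I)
    (k : 'I_(dbsize D)) : R :=
  \sum_(i in trans k) item_utility i k.

Definition occupancy_in (R : realFieldType) (I : finType) (D : uqdb R I)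
    (X : {set I}) (k : 'I_(dbsize D)) : R :=
  utility_in X k / trans_utility k.

(* Takes the conventional value 0 when no transaction supports X. *)
Definition utility_occupancy (R : realFieldType) (I : finType) (D : uqdb R I)
    (X : {set I}) : R :=
  (\sum_(k in supporting D X) occupancy_in X k) / (#|supporting D X|)%:R.

Definition prob_in (R : realFieldType) (I : finType) (D : uqdb R I)
    (X : {set I}) (k : 'I_(dbsize D)) : R :=
  \prod_(i in X) prob i k.

Definition pro (R : realFieldType) (I : finType) (D : uqdb R I)
    (X : {set I}) : R :=
  \sum_(k in supporting D X) prob_in X k.

Definition high_probability (R : realFieldType) (I : finType) (D : uqdb R I)
    (gamma : R) (X : {set I}) : bool :=
  gamma <= pro D X.

Definition phuop (R : realFieldType) (I : finType) (D : uqdb R I)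
    (alpha beta gamma : R) (X : {set I}) : bool :=
  [&& alpha * (dbsize D)%:R <= (support_count D X)%:R,
      beta <= utility_occupancy D X
    & gamma <= pro D X].

(* prec is a strict total order; items with equal support counts may come in
   either order. *)
Definition support_ascending (R : realFieldType) (I : finType) (D : uqdb R I)
    (prec : rel I) : Prop :=
  [/\ irreflexive prec,
      transitive prec,
      (forall i j, i != j -> prec i j || prec j i)
    & (forall i j, prec i j ->
         (support_count D [set i] <= support_count D [set j])%N)].

Definition set_prec (I : finType) (prec : rel I) (X : {set I}) (i : I) : bool :=
  [forall j in X, prec j i].

Definition sc_child (I : finType) (prec : rel I) : rel {set I} :=
  fun X Y => [exists i, [&& i \notin X, set_prec prec X i & Y == i |: X]].

(* Reachable from X by at least one parent-to-child step. *)
Definition sc_descendant (I : finType) (prec : rel I) (X Y : {set I}) : bool :=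
  [exists Z, sc_child prec X Z && connect (sc_child prec) Z Y].

(* Main.v *)
(** Descendants in the SC-tree are supersets, and [pro] is antitone for
    inclusion: enlarging an itemset drops supporting transactions and multiplies
    each remaining term by probabilities, which are at most 1. *)

Require Import Defs.
From mathcomp Require Import all_boot all_order all_algebra.

Set Implicit Arguments.
Unset Strict Implicit.
Unset Printing Implicit Defensive.

Import Order.TTheory GRing.Theory Num.Theory.
Local Open Scope ring_scope.

Lemma prob_in_ge0 (R : realFieldType) (I : finType) (D : uqdb R I)
    (X : {set I}) (k : 'I_(dbsize D)) :
  X \subset trans k -> 0 <= prob_in X k.
Proof.
move=> /subsetP sXk; apply: prodr_ge0 => i /sXk iT.
by have /andP[/ltW] := prob_itv iT.
Qed.

(** The product over [Y] is the product over [X] times one over [Y :\: X], whose factors lie in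
    [(0,1]]. Containment in [trans k] is what bounds these factors: [prob] is unconstrained
    elsewhere. *)
Lemma prob_in_antitone (R : realFieldType) (I : finType) (D : uqdb R I)
    (X Y : {set I}) (k : 'I_(dbsize D)) :
  X \subset Y -> Y \subset trans k -> prob_in Y k <= prob_in X k.
Proof.
move=> sXY sYk; rewrite /prob_in (big_setID X) /= (setIidPr sXY).
apply: ler_piMr; first exact: prob_in_ge0 (subset_trans sXY sYk).
apply: prodr_ile1 => i; rewrite inE => /andP[_ /(subsetP sYk) iT].
by have /andP[/ltW -> ->] := prob_itv iT.
Qed.

Lemma supporting_antitone (R : realFieldType) (I : finType) (D : uqdb R I)
    (X Y : {set I}) :
  X \subset Y -> supporting D Y \subset supporting D X.
Proof.
by move=> sXY; apply/subsetP => k; rewrite !inE; apply: subset_trans.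
Qed.

Lemma pro_antitone (R : realFieldType) (I : finType) (D : uqdb R I)
    (X Y : {set I}) :
  X \subset Y -> pro D Y <= pro D X.
Proof.
move=> sXY; rewrite /pro [leRHS](big_setID (supporting D Y)) /=.
(* The added 0 is matched with the transactions that contain [X] but not [Y]; the other summands are
   compared termwise over [supporting D Y]. *)
rewrite (setIidPr (supporting_antitone D sXY)) -[leLHS]addr0.
apply: lerD.
  by apply: ler_sum => k; rewrite inE; apply: prob_in_antitone.
by apply: sumr_ge0 => k; rewrite !inE => /andP[_]; apply: prob_in_ge0.
Qed.

Lemma sc_child_sub (I : finType) (prec : rel I) (X Y : {set I}) :
  sc_child prec X Y -> X \subset Y.
Proof. by case/existsP => i /and3P[_ _ /eqP ->]; apply: subsetU1. Qed.

Lemma sc_descendant_sub (I : finType) (prec : rel I) (X Y : {set I}) :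
  sc_descendant prec X Y -> X \subset Y.
Proof.
case/existsP => Z /andP[/sc_child_sub sXZ /connectP[p pP ->]].
(* The start [Z] of the path varies in the induction while [X] stays fixed; the invariant is that
   the current node contains [X]. *)
elim: p Z sXZ pP => [|W p IHp] Z sXZ //= /andP[/sc_child_sub sZW].
exact/IHp/(subset_trans sXZ).
Qed.

Lemma phuop_high_probability (R : realFieldType) (I : finType) (D : uqdb R I)
    (alpha beta gamma : R) (X : {set I}) :
  phuop D alpha beta gamma X -> high_probability D gamma X.
Proof. by case/and3P. Qed.

Theorem mainTheorem2 (R : realFieldType) (I : finType) (D : uqdb R I)
    (alpha beta gamma : R) (prec : rel I) (X : {set I})
    (halpha : 0 < alpha <= 1)
    (hprec : support_ascending D prec)
    (hX : X != set0) :
  (gamma <= pro D X -> high_probability D gamma X) /\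
  (pro D X < gamma ->
     ~~ phuop D alpha beta gamma X /\
     (forall Y : {set I}, sc_descendant prec X Y ->
        ~~ phuop D alpha beta gamma Y)).
Proof.
split=> // proX_lt.
(* Stated for arbitrary supersets, this covers both [X] itself, by reflexivity of inclusion, and
   every descendant. *)
have prune (Y : {set I}) : X \subset Y -> ~~ phuop D alpha beta gamma Y.
  move=> sXY; apply/negP => /phuop_high_probability.
  by rewrite /high_probability leNgt (le_lt_trans (pro_antitone D sXY) proX_lt).
by split=> [|Y /sc_descendant_sub]; apply: prune.
Qed.
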